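(* Let $b\ge2$ be an integer, let $g:\mathbb{Z}_{\ge0}\to\mathbb{C}$ be an arbitrary sequence, and define formally, for $n\ge1$, \[ f(n)=\sum_{k\ge0}\sum_{l=0}^{b^{k}-1}g\left(b^{k}n+l\right). \] Then, as identities of formal sums, $g(n)=f(n)-\sum_{j=0}^{b-1}f(bn+j)$ for every $n\ge 1$, and \[ \sum_{n\ge1}s_{b}(n)g(n)=\sum_{j=1}^{b-1}j\sum_{n,k\ge0}\sum_{l=0}^{b^{k}-1}g\left(b^{k+1}n+b^{k}j+l\right). \]
   Context: $s_b(n)$ denotes the sum of the digits of the base-$b$ expansion of $n$. ''Identity of formal sums'' means: when both sides are expanded as formal linear combinations of the symbols $g(m)$, $m\ge0$, each symbol $g(m)$ occurs with the same (finite) coefficient on both sides. *)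

(* Defs.v *)
From mathcomp Require Import all_boot all_order all_algebra.
From mathcomp Require Import all_classical.

Set Implicit Arguments.
Unset Strict Implicit.
Unset Printing Implicit Defensive.

Import Order.TTheory GRing.Theory Num.Theory.

Local Open Scope classical_set_scope.
Local Open Scope ring_scope.

(* A (possibly infinite) formal linear combination of the symbols g(0), g(1),
   ... is the function sending m to the coefficient of g(m).  Only integer
   coefficients occur.  Finite sums, differences and multiples are those of the
   pointwise Z-module structure on functions. *)
Notation formal := (nat -> int).

(* The symbol g(m) itself. *)
Definition gsym (m : nat) : formal := fun i => (i == m)%:R.

(* The formal sum of the F i, i \in A, can be expanded: each symbol occurs in
   only finitely many of the F i, so it gets a finite coefficient. *)
Definition expandable (I : choiceType) (A : set I) (F : I -> formal) : Prop :=
  forall m : nat, finite_set [set i | A i /\ F i m != 0].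

(* Coefficient of g(m) in the sum of the F i, i \in A.  The library sum is 0 by
   convention when the support is infinite, so this is meaningful only together
   with [expandable A F]. *)
Definition fsum (I : choiceType) (A : set I) (F : I -> formal) : formal :=
  fun m => \sum_(i \in A) F i m.

(* The coefficient of b ^ i in the base-b expansion of n is
   floor (n / b ^ i) mod b; it vanishes for i > n when b >= 2. *)
Definition digit (b n i : nat) : nat := ((n %/ b ^ i) %% b)%N.

Definition digit_sum (b n : nat) : nat := (\sum_(i < n.+1) digit b n i)%N.

Lemma digit_lt (b n i : nat) : (2 <= b)%N -> (digit b n i < b)%N.
Proof. by move=> hb; rewrite ltn_mod (ltn_trans _ hb). Qed.

Lemma digit_expansion (b n : nat) :
  (2 <= b)%N -> n = (\sum_(i < n.+1) digit b n i * b ^ i)%N.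
Proof.
move=> hb.
have H N : n = (\sum_(i < N) digit b n i * b ^ i + n %/ b ^ N * b ^ N)%N.
  elim: N => [|N {1}->]; first by rewrite big_ord0 expn0 divn1 muln1.
  rewrite big_ord_recr /= -addnA; congr addn.
  rewrite /digit expnSr divnMA {1}(divn_eq (n %/ b ^ N) b).
  by rewrite mulnDl addnC -mulnA (mulnC b).
rewrite {1}(H n.+1) divn_small ?mul0n ?addn0 //.
by rewrite (ltn_trans (ltnSn n)) // ltn_expl.
Qed.

Definition fterm (b n k : nat) : formal :=
  \sum_(0 <= l < b ^ k) gsym (b ^ k * n + l).

Definition f (b n : nat) : formal := fsum [set: nat] (fterm b n).

(* Main.v *)
(* The block b^k * q, ..., b^k * q + b^k - 1 consists of the m with
   floor(m / b^k) = q.  Hence f(n) counts the k with floor(m / b^k) = n, and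
   summing over the children bn + j shifts k by one, so the first identity
   telescopes.  In the second identity, b^k * (bn + j) <= m < b^k * (bn + j + 1)
   means that the k-th digit of m is j and n = floor(m / b^(k+1)), so the
   right-hand side adds up the digits of m. *)

Require Import Defs.
From mathcomp Require Import all_boot all_order all_algebra.
From mathcomp Require Import all_classical.

Import GRing.Theory.

Local Open Scope classical_set_scope.
Local Open Scope ring_scope.

Lemma divn_exp_small (b m k : nat) :
  (2 <= b)%N -> (m <= k)%N -> (m %/ b ^ k = 0)%N.
Proof. by move=> hb mk; rewrite divn_small // (leq_ltn_trans mk) // ltn_expl. Qed.

Lemma digit_eq0 (b m k : nat) : (2 <= b)%N -> (m <= k)%N -> digit b m k = 0%N.
Proof. by move=> hb mk; rewrite /digit divn_exp_small // mod0n. Qed.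

Lemma expandable_seq (I : choiceType) (A : set I) (F : I -> formal)
    (r : nat -> seq I) :
  (forall m i, A i -> i \notin r m -> F i m = 0) -> expandable A F.
Proof.
move=> F0 m; apply: (sub_finite_set (B := [set` r m])) => // i [Ai Fi] /=.
by apply: contraNT Fi => ir; rewrite F0.
Qed.

Lemma fsum_seq (I : choiceType) (A : set I) (F : I -> formal) (r : seq I) m :
  uniq r -> [set` r] `<=` A -> (forall i, A i -> i \notin r -> F i m = 0) ->
  fsum A F m = \sum_(i <- r) F i m.
Proof.
move=> ur rA F0; rewrite /fsum (fsbigE r) // big_seq_cond [RHS]big_seq.
by apply: eq_bigl => i; case: (boolP (i \in r)) => //= /rA; apply: mem_set.
Qed.

Lemma coef_block (d q m : nat) : (0 < d)%N ->
  (\sum_(0 <= l < d) gsym (d * q + l)) m = (m %/ d == q)%N%:R :> int.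
Proof.
move=> d0; rewrite fct_sumE /gsym.
have [<-|qm] := eqVneq.
  (* Inside its block, [m] is hit by the single offset [l = m %% d]. *)
  rewrite big_mkord (bigD1 (Ordinal (ltn_pmod m d0))) //= mulnC -divn_eq eqxx.
  rewrite big1 ?addr0 // => i; rewrite -val_eqE /= => im.
  by rewrite {1}(divn_eq m d) eqn_add2l eq_sym (negbTE im).
rewrite big_nat big1 // => l /andP[_ ld]; case: eqP => // mE.
by rewrite mE mulnC divnMDl // divn_small // addn0 eqxx in qm.
Qed.

Lemma divn_eq_child (b m n j : nat) : (j < b)%N ->
  (m == b * n + j)%N = ((m %% b == j) && (m %/ b == n))%N.
Proof.
move=> jb; have b0 : (0 < b)%N by case: (b) jb.
apply/eqP/andP => [->|[/eqP <- /eqP <-]].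
  by rewrite mulnC modnMDl modn_small // divnMDl // divn_small // addn0 !eqxx.
by rewrite mulnC -divn_eq.
Qed.

(** Used with [q] a digit of [m]: a constant [c] merges the children of a block, and [c j = j]
    recovers the value of the digit. *)
Lemma sum_eq_nat (b q : nat) (c : nat -> int) : (q < b)%N ->
  \sum_(0 <= j < b) (q == j)%:R * c j = c q.
Proof.
move=> qb; rewrite big_mkord (bigD1 (Ordinal qb)) //= eqxx mul1r.
rewrite big1 ?addr0 // => i; rewrite -val_eqE /= eq_sym => /negbTE ->.
by rewrite mul0r.
Qed.

Section Base.
Variables (b : nat) (hb : (2 <= b)%N).

Lemma base_exp_gt0 k : (0 < b ^ k)%N.
Proof. by rewrite expn_gt0 (ltn_trans _ hb). Qed.

Lemma ftermE n k m : fterm b n k m = (m %/ b ^ k == n)%N%:R.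
Proof. exact/coef_block/base_exp_gt0. Qed.

Lemma fterm_eq0 n k m : (1 <= n)%N -> (m <= k)%N -> fterm b n k m = 0.
Proof.
by move=> n0 mk; rewrite ftermE divn_exp_small // eq_sym (negbTE (lt0n_neq0 n0)).
Qed.

Lemma expandable_fterm n : (1 <= n)%N -> expandable [set: nat] (fterm b n).
Proof.
move=> n0; apply: (@expandable_seq _ _ _ (iota 0)) => m k _.
by rewrite mem_iota /= add0n -leqNgt; apply: fterm_eq0.
Qed.

(** From [k = m] on, [b ^ k * n > m], so every block starts beyond [m]. The cutoff [N] is left free
    so that the telescoping can use two different ones. *)
Lemma fE n m N : (1 <= n)%N -> (m <= N)%N ->
  f b n m = \sum_(0 <= k < N) fterm b n k m.
Proof.
move=> n0 mN; apply: fsum_seq => [|//|k _]; first exact: iota_uniq.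
rewrite mem_iota /= add0n subn0 -leqNgt => Nk.
by rewrite fterm_eq0 // (leq_trans mN).
Qed.

Lemma sum_fterm_children n k m :
  \sum_(0 <= j < b) fterm b (b * n + j) k m = fterm b n k.+1 m.
Proof.
rewrite ftermE expnSr divnMA.
(* The indicator for [n] is spread over the children: only the child indexed by the [k]-th digit of
   [m] can have a block containing [m]. *)
rewrite -[RHS](@sum_eq_nat b ((m %/ b ^ k) %% b)%N
  (fun=> ((m %/ b ^ k) %/ b == n)%N%:R)); last by rewrite ltn_mod (ltn_trans _ hb).
rewrite big_nat [RHS]big_nat; apply: eq_bigr => j /andP[_ jb].
by rewrite ftermE divn_eq_child // -natrM mulnb.
Qed.

Lemma gsym_f n : (1 <= n)%N ->
  gsym n = f b n - \sum_(0 <= j < b) f b (b * n + j).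
Proof.
move=> n0; apply/funext => m.
rewrite -[RHS]/(f b n m - (\sum_(0 <= j < b) f b (b * n + j)) m) fct_sumE.
have bn j : (1 <= b * n + j)%N.
  by rewrite ltn_addr // muln_gt0 n0 (ltn_trans _ hb).
under eq_bigr do rewrite (fE _ _ _ (bn _) (leqnn m)).
rewrite exchange_big_nat /=; under eq_bigr do rewrite sum_fterm_children.
(* With cutoff [m.+1] here against [m] for the children, exactly the term [k = 0] survives, the
   indicator of [m = n]. *)
by rewrite (fE _ _ _ n0 (leqnSn m)) big_nat_recl // addrK ftermE divn1.
Qed.

Lemma coef_digit_block n k j m : (j < b)%N ->
  (\sum_(0 <= l < b ^ k) gsym (b ^ k.+1 * n + b ^ k * j + l)) m =
  ((digit b m k == j) && (m %/ b ^ k.+1 == n))%N%:R :> int.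
Proof.
move=> jb; rewrite expnSr divnMA -divn_eq_child // -coef_block ?base_exp_gt0 //.
by under eq_bigr do rewrite -mulnA -mulnDr.
Qed.

(* The index pairs (n, k) of the blocks that can contain m. *)
Let pairs m := [seq ((m %/ b ^ k.+1)%N, k) | k <- iota 0 m.+1].

Lemma coef_digit_block_eq0 j m nk : (1 <= j < b)%N -> nk \notin pairs m ->
  (\sum_(0 <= l < b ^ nk.2)
     gsym (b ^ nk.2.+1 * nk.1 + b ^ nk.2 * j + l)) m = 0 :> int.
Proof.
case: nk => n k /andP[j0 jb] /= nk; rewrite coef_digit_block //.
have [jE|//] := eqVneq (digit b m k); have [nE|//] /= := eqVneq.
case/negP: nk; apply/mapP; exists k; last by rewrite nE.
(* Here [1 <= j] is essential: all digits beyond position [m] are 0, so for [j = 0] the blocks with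
   [n = 0] would contain [m] for every large [k]. *)
rewrite mem_iota /= add0n ltnS leqNgt; apply: contraL j0 => /ltnW mk.
by rewrite -jE digit_eq0.
Qed.

(** For each [k] only [n = m %/ b ^ k.+1] can contribute, so the double sum collapses to a count of
    the positions where [m] has digit [j]. *)
Lemma fsum_digit_block j m : (1 <= j < b)%N ->
  fsum [set: nat * nat]
    (fun nk => \sum_(0 <= l < b ^ nk.2)
       gsym (b ^ nk.2.+1 * nk.1 + b ^ nk.2 * j + l)) m =
  \sum_(0 <= k < m.+1) (digit b m k == j)%:R.
Proof.
move=> hj; rewrite (@fsum_seq _ _ _ (pairs m)) //; last first.
- by move=> nk _; apply: coef_digit_block_eq0.
- by rewrite map_inj_uniq ?iota_uniq // => k k' [].
rewrite big_map; apply: eq_bigr => k _ /=.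
by case/andP: hj => _ jb; rewrite coef_digit_block // eqxx andbT.
Qed.

Lemma coef_gsym_digit_sum n m :
  (gsym n *+ digit_sum b n) m = (if m == n then digit_sum b n else 0%N)%:R.
Proof. by rewrite natmulfctE /gsym; case: eqP => // _; rewrite mul0rn. Qed.

Lemma fsum_gsym_digit_sum m :
  fsum [set n : nat | (1 <= n)%N] (fun n => gsym n *+ digit_sum b n) m =
  (digit_sum b m)%:R.
Proof.
(* The symbol g(0) does not occur in the sum over [n >= 1], in agreement with the digit sum of 0
   being 0. *)
case: m => [|m].
  rewrite (@fsum_seq _ _ _ [::]) // => [|[|n] //= _ _].
    by rewrite big_nil /digit_sum big_ord1 digit_eq0.
  by rewrite coef_gsym_digit_sum.
rewrite (@fsum_seq _ _ _ [:: m.+1]) //=; first last.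
- by move=> n _; rewrite inE eq_sym coef_gsym_digit_sum => /negbTE ->.
- by move=> n /=; rewrite inE => /eqP ->.
by rewrite big_seq1 coef_gsym_digit_sum eqxx.
Qed.

End Base.

Theorem theorem27 (b : nat) (hb : (2 <= b)%N) :
  (forall n : nat, (1 <= n)%N ->
     expandable [set: nat] (fterm b n) /\
     gsym n = f b n - \sum_(0 <= j < b) f b (b * n + j)) /\
  expandable [set n : nat | (1 <= n)%N]
    (fun n => gsym n *+ digit_sum b n) /\
  (forall j : nat, (1 <= j < b)%N ->
     expandable [set: nat * nat]
       (fun nk => \sum_(0 <= l < b ^ nk.2)
          gsym (b ^ nk.2.+1 * nk.1 + b ^ nk.2 * j + l))) /\
  fsum [set n : nat | (1 <= n)%N] (fun n => gsym n *+ digit_sum b n) =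
  \sum_(1 <= j < b)
    fsum [set: nat * nat]
      (fun nk => \sum_(0 <= l < b ^ nk.2)
         gsym (b ^ nk.2.+1 * nk.1 + b ^ nk.2 * j + l)) *+ j.
Proof.
split=> [n n0|]; first by split; [apply: expandable_fterm|apply: gsym_f].
split; [|split=> [j hj|]].
- apply: (@expandable_seq _ _ _ (fun m => [:: m])) => m n _.
  by rewrite inE eq_sym coef_gsym_digit_sum => /negbTE ->.
- by apply: expandable_seq => m nk _; apply: coef_digit_block_eq0.
apply/funext => m; rewrite fsum_gsym_digit_sum // fct_sumE.
under eq_big_nat => j hj.
  rewrite natmulfctE fsum_digit_block // -mulr_natr mulr_suml; over.
rewrite exchange_big_nat /= /digit_sum natr_sum big_mkord.
apply: eq_bigr => k _.
(* The [k]-th digit is the sum of [j] times the indicator that it equals [j]; the term [j = 0] has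
   weight 0, so starting at 1 loses nothing. *)
rewrite -[LHS](@sum_eq_nat b (digit b m k) (fun j => j%:R)) ?digit_lt //.
by rewrite [LHS]big_ltn ?(ltn_trans _ hb) // mulr0 add0r.
Qed.
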